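(* For every partition $\lambda\vdash m$ and every vector $\vec m=[m_1,\dots,m_n]$ of nonnegative integers with $m_1+\cdots+m_n=m$, the function $S_\lambda^{\vec m}$ is a MacMahon symmetric function.
   Context: Take $n$ sets of commuting variables $\{x^{(k)}_1,x^{(k)}_2,\ldots\}$, $k=1,\dots,n$. For each $m'\ge1$, $g\in\mathfrak S_{m'}$ acts on $\mathbb{Q}[[x^{(k)}_i]]$ diagonally by $x^{(k)}_i\mapsto x^{(k)}_{g(i)}$ for all $k$ (with $g(i)=i$ for $i>m'$). A series is MacMahon symmetric if it has bounded degree and is invariant under all these actions. Let $A=\{i^{(k)}: i\ge1,\ 1\le k\le n\}$ (think of $i^{(k)}$ as $i$ with $k$ dots), partially ordered by $i^{(k)}<j^{(l)}$ iff $i<j$. A dotted Young tableau of shape $\lambda$ and multidegree $\vec m$ is a filling of the Young diagram of $\lambda$ (English convention) with elements of $A$ such that rows are weakly increasing and columns strictly increasing in this order, and exactly $m_k$ entries have $k$ dots, for each $k$. Then $S_\lambda^{\vec m}=\sum_T\prod_{i^{(j)}\in T}x^{(j)}_i$, summed over all dotted Young tableaux $T$ of shape $\lambda$ and multidegree $\vec m$, the product taken over entries with multiplicity. *)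

(* Defs.v *)
From mathcomp Require Import all_boot all_algebra all_fingroup finmap.
From mathcomp Require Import monalg.
From mathcomp Require Import boolp classical_sets functions cardinality fsbigop.

Set Implicit Arguments.
Unset Strict Implicit.
Unset Printing Implicit Defensive.

Import GRing.Theory.

Local Open Scope nat_scope.

(* Everything is indexed from 0: the pair (i, k) stands for the letter
   (i+1)^(k+1) of A, and also for the variable x^(k+1)_(i+1). *)
Definition dotted (n : nat) : choiceType := (nat * 'I_n)%type.

Definition dlt n (a b : dotted n) : bool := a.1 < b.1.

(* Letters with the same underlying integer but different dots are incomparable,
   and such letters may be adjacent in a row in either order: "weakly
   increasing" means that no entry is smaller than one to its left. *)
Definition dle n (a b : dotted n) : bool := ~~ dlt b a.

(* Formal power series over Q, as coefficient functions on the monomials in the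
   commuting variables x^(k)_i. *)
Definition series (n : nat) : Type := {cmonom dotted n} -> rat.

Definition perm_nat m (g : 'S_m) (i : nat) : nat :=
  if insub i is Some j then val (g j) else i.

Definition perm_dotted n m (g : 'S_m) (a : dotted n) : dotted n :=
  (perm_nat g a.1, a.2).

Definition perm_monom n m (g : 'S_m) (M : {cmonom dotted n}) :
    {cmonom dotted n} :=
  \big[mmul/mone]_(a <- finsupp M) expcmn (ucm (perm_dotted g a)) (M a).

(* The coefficient of g M in g f is that of M in f. *)
Definition perm_series n m (g : 'S_m) (f : series n) : series n :=
  fun M => f (perm_monom g^-1%g M).

Definition bounded_degree n (f : series n) : Prop :=
  exists d : nat, forall M : {cmonom dotted n}, f M != 0%R -> mdeg M <= d.

Definition MacMahon_symmetric n (f : series n) : Prop :=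
  bounded_degree f /\
  forall (m : nat) (g : 'S_m), 0 < m -> perm_series g f =1 f.

Definition is_partition (la : seq nat) (m : nat) : bool :=
  [&& sorted geq la, 0 \notin la & sumn la == m].

Definition cell (la : seq nat) : finType :=
  {r : 'I_(size la) & 'I_(nth 0 la r)}.

Definition cell_row la (c : cell la) : nat := tag c.
Definition cell_col la (c : cell la) : nat := tagged c.

Definition filling (la : seq nat) (n : nat) : choiceType :=
  {ffun cell la -> dotted n}.

Definition rows_weakly_increasing la n (T : filling la n) : bool :=
  [forall c, forall d, (cell_row c == cell_row d) && (cell_col c < cell_col d)
     ==> dle (T c) (T d)].

Definition cols_strictly_increasing la n (T : filling la n) : bool :=
  [forall c, forall d, (cell_col c == cell_col d) && (cell_row c < cell_row d)
     ==> dlt (T c) (T d)].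

Definition has_multidegree la n (mm : n.-tuple nat) (T : filling la n) : bool :=
  [forall k, #|[set c | (T c).2 == k]| == tnth mm k].

Definition dotted_tableaux la n (mm : n.-tuple nat) : set (filling la n) :=
  [set T | [&& rows_weakly_increasing T, cols_strictly_increasing T
            & has_multidegree mm T]]%classic.
Arguments dotted_tableaux la {n} mm _.

Definition tableau_monom la n (T : filling la n) : {cmonom dotted n} :=
  \big[mmul/mone]_(c : cell la) ucm (T c).

(* The sum over tableaux is taken coefficientwise; each coefficient is a finite
   sum by finite_tableau_monom below, so the convention that a \sum_(_ \in _)
   with infinite support is 0 plays no role. *)
Definition MacMahon_Schur la n (mm : n.-tuple nat) : series n :=
  fun M =>
    (\sum_(T \in dotted_tableaux la mm) ((tableau_monom T == M)%:R : rat))%R.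
Arguments MacMahon_Schur la {n} mm _.

Lemma tableau_monomE la n (T : filling la n) a :
  tableau_monom T a = \sum_c (T c == a).
Proof.
rewrite /tableau_monom (big_morph (fun M : {cmonom dotted n} => M a)
  (id1 := 0) (op1 := addn)) ?cm1 // => [|x y]; last exact: cmM.
by apply: eq_bigr => c _; rewrite cmU.
Qed.

Lemma finite_tableau_monom la n (M : {cmonom dotted n}) :
  finite_set [set T : filling la n | tableau_monom T = M]%classic.
Proof.
pose h (t : {ffun cell la -> finsupp M}) : filling la n := [ffun c => val (t c)].
apply: (@sub_finite_set _ _ (h @` setT)%classic); last exact: finite_image.
move=> T /= TM.
have TP c : T c \in finsupp M.
  by rewrite mem_finsupp -TM tableau_monomE (bigD1 c) //= eqxx.
by exists [ffun c => FSetSub (TP c)] => //; apply/ffunP => c; rewrite !ffunE.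
Qed.

(* Main.v *)
(* Forgetting the dots, a dotted tableau is a semistandard tableau together with
   an arbitrary placement of the dots.  The Bender-Knuth involutions, composed
   along a factorization of [g] into adjacent transpositions, give a bijection
   of the semistandard tableaux that permutes the content by [g].  The cells of
   a tableau with entry [v] and those of its image with entry [g v] are then
   equally many, so the dots can be carried along by a permutation of the cells
   chosen for each tableau: this turns a dotted tableau with monomial [M] into
   one with monomial [g M], bijectively. *)
Require Import Defs.
From mathcomp Require Import all_boot.
From mathcomp Require Import all_algebra all_fingroup finmap monalg.
From mathcomp Require Import boolp classical_sets functions cardinality fsbigop.
From mathcomp Require Import zify.

Set Implicit Arguments.
Unset Strict Implicit.
Unset Printing Implicit Defensive.

(** * Row lengths and initial segments *)

Lemma nth_sorted_geq (la : seq nat) r r' :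
  sorted geq la -> r <= r' -> nth 0 la r' <= nth 0 la r.
Proof.
move=> sla rr'; case: (ltnP r' (size la)) => hr'; last by rewrite nth_default.
have geqT : transitive geq by move=> y x z /= xy yz; apply: leq_trans yz xy.
by apply: (sorted_leq_nth geqT leqnn 0 sla); rewrite ?inE ?(leq_ltn_trans rr').
Qed.

(** A down-closed subset of [[0, L)] is an initial segment, hence determined by its size. A sorted
    row can thus be read off from its counting functions. *)
Lemma lt_sum_downclosed (P : pred nat) L :
  (forall j k, j <= k -> k < L -> P k -> P j) ->
  forall j, j < L -> P j = (j < \sum_(j < L) P j).
Proof.
elim: L => // L IH dP j; rewrite ltnS big_ord_recr /= => jL.
have sL : \sum_(i < L) P i <= L.
  by rewrite -[leqRHS]card_ord -sum1_card; apply: leq_sum => i _; apply: leq_b1.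
case PL: (P L).
  rewrite (dP j L) // (eq_bigr (fun=> 1)) => [|i _].
    by rewrite sum1_card card_ord addn1 ltnS jL.
  by rewrite (dP i L) // ltnW.
rewrite addn0; case: (ltngtP j L) jL => // [jL _|-> _].
  by apply: IH => // j' k jk kL; apply: dP => //; apply: ltnW.
by rewrite PL ltnNge sL.
Qed.

Lemma sum_ltn L x : \sum_(j < L) (j < x) = minn L x.
Proof. by elim: L => [|L IH]; rewrite ?big_ord0 ?big_ord_recr /= ?IH; lia. Qed.

Definition swap_nat (x y z : nat) : nat := if z == x then y else if z == y then x else z.

(** * Semistandard tableaux through row thresholds, and Bender-Knuth involutions *)

Section Thresholds.
Variables (la : seq nat).
Hypothesis sla : sorted geq la.
Implicit Types (f : nat -> nat -> nat) (q : nat -> nat -> nat).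

Definition ssyt f :=
  (forall r j k, j <= k -> k < nth 0 la r -> f r j <= f r k) /\
  (forall r r' j, r < r' -> j < nth 0 la r' -> f r j < f r' j).

(** In a sorted row this is the column where the entries [>= v] begin; these thresholds form the
    Gelfand-Tsetlin pattern of the tableau. *)
Definition row_lt f v r := \sum_(j < nth 0 la r) (f r j < v).

Definition row_content f v := \sum_(r < size la) \sum_(j < nth 0 la r) (f r j == v).

Lemma row_lt_max f v r : row_lt f v r <= nth 0 la r.
Proof.
by rewrite -[leqRHS]card_ord -sum1_card; apply: leq_sum => i _; apply: leq_b1.
Qed.

Lemma row_lt_mono f v w r : v <= w -> row_lt f v r <= row_lt f w r.
Proof. by move=> vw; apply: leq_sum => j _; have := ltn_ord j; lia. Qed.

Lemma row_ltP f v r j : ssyt f -> j < nth 0 la r -> (f r j < v) = (j < row_lt f v r).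
Proof.
move=> [fr _]; apply: (@lt_sum_downclosed (fun j => f r j < v)) => {}j k jk kL.
by apply: leq_ltn_trans; apply: fr.
Qed.

(** Otherwise, in column [row_lt f v r], row [r.+1] has an entry at most [v], so the entry above it
    is below [v], although the entries [< v] of row [r] end just before that column. *)
Lemma row_lt_interlace f v r : ssyt f -> row_lt f v.+1 r.+1 <= row_lt f v r.
Proof.
move=> sf; rewrite leqNgt; apply/negP => lt.
have xL : row_lt f v r < nth 0 la r.+1 by apply: leq_trans lt (row_lt_max _ _ _).
have xL' := leq_trans xL (nth_sorted_geq sla (leqnSn r)).
move: lt; rewrite -row_ltP // => lt.
have := sf.2 r r.+1 _ (ltnSn r) xL => lt2.
have : f r (row_lt f v r) < v by lia.
by rewrite row_ltP // ltnn.
Qed.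

(** Both tableau conditions become threshold inequalities once [v] is taken to be an entry of [f] or
    its successor: rows follow from initial segments, columns from interlacing. *)
Lemma threshold_ssyt f q :
  (forall v r j, j < nth 0 la r -> (f r j < v) = (j < q v r)) ->
  (forall v r, q v.+1 r.+1 <= q v r) -> ssyt f.
Proof.
move=> fq qq; split.
  move=> r j k jk kL; rewrite -ltnS fq; last exact: leq_ltn_trans kL.
  by apply: leq_ltn_trans jk _; rewrite -fq.
move=> r r' j; elim: r' => // r' IH.
have step : j < nth 0 la r'.+1 -> f r' j < f r'.+1 j.
  move=> jL; have jL' := leq_trans jL (nth_sorted_geq sla (leqnSn r')).
  by rewrite fq //; apply: leq_trans (qq _ _); rewrite -fq.
rewrite ltnS leq_eqVlt => /predU1P[->|rr'] jL; first exact: step.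
have jL' := leq_trans jL (nth_sorted_geq sla (leqnSn r')).
exact: ltn_trans (IH rr' jL') (step jL).
Qed.

Lemma threshold_row_lt f x v r :
  (forall j, j < nth 0 la r -> (f r j < v) = (j < x)) -> x <= nth 0 la r ->
  row_lt f v r = x.
Proof.
move=> fx xL; rewrite /row_lt (eq_bigr (fun j : 'I__ => j < x : nat)).
  by rewrite sum_ltn; apply/minn_idPr.
by move=> j _; rewrite fx.
Qed.

Lemma row_contentE f v :
  row_content f v + \sum_(r < size la) row_lt f v r = \sum_(r < size la) row_lt f v.+1 r.
Proof.
rewrite -big_split; apply: eq_bigr => r _; rewrite -big_split.
by apply: eq_bigr => j _ /=; lia.
Qed.

Variable i : nat.

(* With [row_lt f i] and [row_lt f i.+2] fixed, the lengths [row_lt f i.+1 r]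
   that keep [f] semistandard are exactly those in [bk_lo f r, bk_hi f r]; the
   Bender-Knuth involution [bk] reflects each of them in its interval. *)
Definition bk_lo f r := maxn (row_lt f i r) (row_lt f i.+2 r.+1).
Definition bk_hi f r :=
  if r is r'.+1 then minn (row_lt f i.+2 r) (row_lt f i r') else row_lt f i.+2 r.
Definition bk_mid f r := bk_lo f r + bk_hi f r - row_lt f i.+1 r.

Definition bk f r j :=
  if (f r j == i) || (f r j == i.+1) then
    if j < bk_mid f r then i else i.+1
  else f r j.

(** Monotonicity and interlacing of the thresholds give both bounds, which also make the truncated
    subtraction in [bk_mid] exact. *)
Lemma bk_bounds f r : ssyt f -> bk_lo f r <= row_lt f i.+1 r <= bk_hi f r.
Proof.
move=> sf; rewrite /bk_lo /bk_hi.
have i1 := row_lt_interlace i.+1 r sf.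
have m1 := row_lt_mono f r (leqnSn i); have m2 := row_lt_mono f r (leqnSn i.+1).
case: r i1 m1 m2 => [|r] i1 m1 m2; first by lia.
by have i2 := row_lt_interlace i r sf; lia.
Qed.

Lemma bk_mid_bounds f r : ssyt f -> bk_lo f r <= bk_mid f r <= bk_hi f r.
Proof. by move=> /(bk_bounds r); rewrite /bk_mid; lia. Qed.

Lemma bk_hi_max f r : bk_hi f r <= row_lt f i.+2 r.
Proof. by rewrite /bk_hi; case: r => [|r]; lia. Qed.

(** The thresholds of [bk f]: only the one at [i.+1] moves. *)
Let q f v r := if v == i.+1 then bk_mid f r else row_lt f v r.

Lemma bk_ltP f v r j : ssyt f -> j < nth 0 la r -> (bk f r j < v) = (j < q f v r).
Proof.
move=> sf jL; rewrite /q.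
have e1 := row_ltP i sf jL; have e2 := row_ltP i.+2 sf jL; have e3 := row_ltP v sf jL.
have := bk_mid_bounds r sf; have := bk_hi_max f r.
have : row_lt f i r <= bk_lo f r by rewrite leq_maxl.
rewrite /bk; case: (v =P i.+1) => [->|nv]; case: ifP => e; try case: ifP; lia.
Qed.

Lemma bk_row_lt f v r : ssyt f -> row_lt (bk f) v r = q f v r.
Proof.
move=> sf; apply: threshold_row_lt => [j jL|]; first exact: bk_ltP.
rewrite /q; case: ifP => _; last exact: row_lt_max.
have := bk_mid_bounds r sf; have := bk_hi_max f r; have := row_lt_max f i.+2 r; lia.
Qed.

(** Interlacing is at stake only for [v = i] and [v = i.+1], where it is the upper bound on row
    [r.+1] and the lower bound on row [r]. *)
Lemma bk_ssyt f : ssyt f -> ssyt (bk f).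
Proof.
move=> sf; apply: (@threshold_ssyt _ (q f)) => [v r j|v r]; first exact: bk_ltP.
rewrite /q; case: (v =P i) => [->|nv].
  rewrite eqxx; have := bk_mid_bounds r.+1 sf; rewrite /bk_hi.
  by case: eqP => [|_]; lia.
case: eqP => [|_]; first by lia.
case: eqP => [->|_]; last exact: row_lt_interlace.
by have := bk_mid_bounds r sf; rewrite /bk_lo; lia.
Qed.

(** The interval ends involve only the thresholds at [i] and [i.+2], which [bk] keeps, so the second
    reflection undoes the first. *)
Lemma bkK f r j : ssyt f -> j < nth 0 la r -> bk (bk f) r j = f r j.
Proof.
move=> sf jL; have sbf := bk_ssyt sf.
suff lt v : (bk (bk f) r j < v) = (f r j < v).
  by apply/eqP; rewrite eqn_leq -ltnS lt ltnS leqnn /= -ltnS -lt.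
rewrite bk_ltP // row_ltP // /q; case: eqP => [->|nv].
  have lo : bk_lo (bk f) r = bk_lo f r.
    by rewrite /bk_lo !bk_row_lt // /q; do !case: eqP => //; lia.
  have hi : bk_hi (bk f) r = bk_hi f r.
    rewrite /bk_hi; case: r {lo jL} => [|r]; rewrite !bk_row_lt // /q;
    by do !case: eqP => //; lia.
  rewrite /bk_mid lo hi bk_row_lt // /q eqxx.
  by have := bk_bounds r sf; rewrite /bk_mid; lia.
by rewrite bk_row_lt // /q; case: eqP.
Qed.

(* The upper bound of row [r+1] pairs with the lower bound of row [r], as
   [maxn x y + minn y x = x + y]. *)
Lemma sum_bk_bounds f n :
  \sum_(r < n) (bk_lo f r + bk_hi f r) + bk_hi f n =
  \sum_(r < n) (row_lt f i r + row_lt f i.+2 r) + row_lt f i.+2 n.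
Proof.
elim: n => [|n IH]; first by rewrite !big_ord0.
rewrite !big_ord_recr /=; move: IH; rewrite [bk_lo f n]/bk_lo.
by move: (bk_hi f n) (\sum_(r < n) _) (\sum_(r < n) _) => *; lia.
Qed.

Lemma sum_bk_mid f : ssyt f ->
  \sum_(r < size la) bk_mid f r + \sum_(r < size la) row_lt f i.+1 r =
  \sum_(r < size la) row_lt f i r + \sum_(r < size la) row_lt f i.+2 r.
Proof.
move=> sf; have := sum_bk_bounds f (size la).
(* The row just past the last one is empty, so the boundary terms of [sum_bk_bounds] vanish. *)
have row0 v : row_lt f v (size la) = 0 by rewrite /row_lt nth_default // big_ord0.
have -> : bk_hi f (size la) = 0.
  by apply/eqP; rewrite -leqn0 -(row0 i.+2) bk_hi_max.
rewrite row0 !addn0 -!big_split /= => <-; apply: eq_bigr => r _.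
by have := bk_bounds r sf; rewrite /bk_mid; lia.
Qed.

(** By [sum_bk_mid] the total threshold at [i.+1] is reflected between those at [i] and [i.+2];
    contents are differences of consecutive totals, so those of [i] and [i.+1] are exchanged. *)
Lemma bk_content f v : ssyt f ->
  row_content (bk f) (swap_nat i i.+1 v) = row_content f v.
Proof.
move=> sf; have sm := sum_bk_mid sf.
have e1 u : u != i.+1 ->
    \sum_(r < size la) row_lt (bk f) u r = \sum_(r < size la) row_lt f u r.
  by move=> /negPf nu; apply: eq_bigr => r _; rewrite bk_row_lt // /q nu.
have e2 : \sum_(r < size la) row_lt (bk f) i.+1 r = \sum_(r < size la) bk_mid f r.
  by apply: eq_bigr => r _; rewrite bk_row_lt // /q eqxx.
rewrite /swap_nat; case: (v =P i) => [->|/eqP nvi].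
  by move: (row_contentE (bk f) i.+1) (row_contentE f i);
    rewrite e2 (e1 i.+2) ?gtn_eqF //; lia.
case: (v =P i.+1) => [->|/eqP nvi1].
  by move: (row_contentE (bk f) i) (row_contentE f i.+1);
    rewrite e2 (e1 i) ?ltn_eqF //; lia.
by move: (row_contentE (bk f) v) (row_contentE f v); rewrite !e1 //; lia.
Qed.

End Thresholds.

(** Needed because [extend (restrict f)] agrees with [f] only inside the diagram. *)
Lemma eq_bk la i f g :
  (forall r j, j < nth 0 la r -> f r j = g r j) ->
  forall r j, j < nth 0 la r -> bk la i f r j = bk la i g r j.
Proof.
move=> fg r j jL.
have rl v r' : row_lt la f v r' = row_lt la g v r'.
  by apply: eq_bigr => k _; rewrite fg.
have hi : bk_hi la i f r = bk_hi la i g r.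
  by rewrite /bk_hi; case: (r) => [|r']; rewrite !rl.
by rewrite /bk /bk_mid /bk_lo hi !rl fg.
Qed.

(** * Fillings of cells and bijections permuting the content *)

Section Cells.
Variable la : seq nat.

Definition semistandard (U : {ffun cell la -> nat}) : bool :=
  [forall c, forall d, (cell_row c == cell_row d) && (cell_col c < cell_col d)
     ==> (U c <= U d)] &&
  [forall c, forall d, (cell_col c == cell_col d) && (cell_row c < cell_row d)
     ==> (U c < U d)].

Definition extend (U : {ffun cell la -> nat}) (r j : nat) : nat :=
  if (insub r : option 'I_(size la)) is Some r' then
    if insub j is Some j' then
      U (Tagged (fun r0 : 'I_(size la) => 'I_(nth 0 la r0)) (j' : 'I_(nth 0 la r')))
    else 0
  else 0.

Definition restrict (f : nat -> nat -> nat) : {ffun cell la -> nat} :=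
  [ffun c => f (cell_row c) (cell_col c)].

Lemma extendE U c : extend U (cell_row c) (cell_col c) = U c.
Proof. by case: c => r j; rewrite /extend /cell_row /cell_col /= !valK. Qed.

Lemma cell_colP (c : cell la) : cell_col c < nth 0 la (cell_row c).
Proof. by case: c => r j; apply: ltn_ord. Qed.

Lemma cellP r j :
  j < nth 0 la r -> exists2 c : cell la, cell_row c = r & cell_col c = j.
Proof.
move=> jL; have rL : r < size la.
  by rewrite ltnNge; apply/negP => rL; rewrite nth_default in jL.
by exists (Tagged (fun r : 'I_(size la) => 'I_(nth 0 la r))
             (Ordinal jL : 'I_(nth 0 la (Ordinal rL)))).
Qed.

Lemma extendK U : restrict (extend U) = U.
Proof. by apply/ffunP => c; rewrite ffunE extendE. Qed.

Lemma restrictK f r j : j < nth 0 la r -> extend (restrict f) r j = f r j.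
Proof. by case/cellP => c <- <-; rewrite extendE ffunE. Qed.

Hypothesis sla : sorted geq la.

Lemma extend_ssyt U : semistandard U -> ssyt la (extend U).
Proof.
case/andP => /forallP rowU /forallP colU; split.
  move=> r j k; rewrite leq_eqVlt => /predU1P[->//|jk kL].
  have [c cr cj] := cellP (ltn_trans jk kL); have [d dr dk] := cellP kL.
  have := forallP (rowU c) d; rewrite -!extendE cr cj dr dk eqxx jk.
  exact.
move=> r r' j rr' jL'; have jL := leq_trans jL' (nth_sorted_geq sla (ltnW rr')).
have [c cr cj] := cellP jL; have [d dr dj] := cellP jL'.
have := forallP (colU c) d; rewrite -!extendE cr cj dr dj eqxx rr'.
exact.
Qed.

Lemma restrict_ssyt f : ssyt la f -> semistandard (restrict f).
Proof.
move=> [rowf colf]; apply/andP; split.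
  apply/forallP => c; apply/forallP => d; apply/implyP => /andP[/eqP cd lt].
  by rewrite !ffunE cd; apply: rowf; [apply: ltnW | apply: cell_colP].
apply/forallP => c; apply/forallP => d; apply/implyP => /andP[/eqP cd lt].
by rewrite !ffunE cd; apply: colf => //; apply: cell_colP.
Qed.

Lemma row_content_extend U v :
  row_content la (extend U) v = \sum_c (U c == v).
Proof.
rewrite /row_content.
rewrite (sig_big_dep (fun=> true) (fun _ _ => true)
  (fun (r : 'I_(size la)) (j : 'I_(nth 0 la r)) => (extend U r j == v) : nat)).
by apply: eq_bigr => c _; rewrite -(extendE U c).
Qed.

Lemma eq_row_content f g v :
  (forall r j, j < nth 0 la r -> f r j = g r j) ->
  row_content la f v = row_content la g v.
Proof.
by move=> fg; apply: eq_bigr => r _; apply: eq_bigr => j _; rewrite fg.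
Qed.

Definition content_bij (s : nat -> nat) : Prop :=
  exists phi : {ffun cell la -> nat} -> {ffun cell la -> nat},
    set_bij [set U | semistandard U]%classic [set U | semistandard U]%classic phi /\
    forall U, semistandard U ->
      forall v, \sum_c (phi U c == s v) = \sum_c (U c == v).

Lemma content_bij_id s : s =1 id -> content_bij s.
Proof.
move=> s1; exists id; split; first by split=> // U ?; exists U.
by move=> U _ v; rewrite s1.
Qed.

Lemma content_bij_comp s t u :
  content_bij s -> content_bij t -> u =1 t \o s -> content_bij u.
Proof.
move=> [phi [bphi cphi]] [psi [bpsi cpsi]] uE.
exists (psi \o phi); split; first exact: set_bij_comp bphi bpsi.
move=> U sU v; rewrite uE /= cpsi ?cphi //.
by case: bphi => + _ _; apply.
Qed.

Lemma content_bij_adjacent i : content_bij (swap_nat i i.+1).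
Proof.
pose phi U := restrict (bk la i (extend U)).
have phiss U : semistandard U -> semistandard (phi U).
  by move=> /extend_ssyt sU; apply/restrict_ssyt/bk_ssyt.
have phiK U : semistandard U -> phi (phi U) = U.
  move=> /extend_ssyt sU; rewrite -[RHS]extendK; apply/ffunP => c.
  rewrite !ffunE -[RHS](bkK sla i sU (cell_colP c)).
  by apply: eq_bk (cell_colP c) => r j; apply: restrictK.
exists phi; split.
  split=> [U /phiss //|U V|U /= sU].
    by rewrite !inE /= => sU sV /(congr1 phi); rewrite !phiK.
  by exists (phi U); [apply: phiss | apply: phiK].
move=> U /extend_ssyt sU v; rewrite -!row_content_extend -(bk_content sla i v sU).
by apply: eq_row_content => r j; apply: restrictK.
Qed.

Lemma content_bij_swap x y : content_bij (swap_nat x y).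
Proof.
wlog xy : x y / x <= y.
  move=> W; case: (leqP x y) => [/W //|/ltnW /W].
  (* Composing with the identity replaces [swap_nat y x] by the pointwise equal [swap_nat x y]. *)
  move/content_bij_comp => /(_ _ _ (content_bij_id (frefl _))); apply => z.
  by rewrite /= /swap_nat; do !case: eqP => //; lia.
elim: y xy => [|y IH] xy.
  by apply: content_bij_id => z; rewrite /swap_nat; do !case: eqP => //; lia.
case: (ltngtP x y) xy => // [lt _|gt le|-> _]; last exact: content_bij_adjacent.
  (* The transposition of [x] and [y.+1] is that of [x] and [y] conjugated by the adjacent one at
     [y]. *)
  have A := content_bij_adjacent y; have B := content_bij_comp A (IH (ltnW lt)) (frefl _).
  apply: content_bij_comp B A _ => z.
  by rewrite /= /swap_nat; do !case: eqP => //; lia.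
by apply: content_bij_id => z; rewrite /swap_nat; do !case: eqP => //; lia.
Qed.

End Cells.

(** * Permutations acting on entries *)

Lemma perm_nat1 m : @perm_nat m 1%g =1 id.
Proof. by move=> i; rewrite /perm_nat; case: insubP => // j _ <-; rewrite perm1. Qed.

Lemma perm_natM m (g h : 'S_m) i : perm_nat (g * h)%g i = perm_nat h (perm_nat g i).
Proof.
rewrite /perm_nat; case: insubP => [j _ _|]; first by rewrite valK permM.
by move=> im; rewrite insubN.
Qed.

Lemma perm_natK m (g : 'S_m) : cancel (perm_nat g) (perm_nat g^-1%g).
Proof. by move=> i; rewrite -perm_natM mulgV perm_nat1. Qed.

Lemma perm_natVK m (g : 'S_m) : cancel (perm_nat g^-1%g) (perm_nat g).
Proof. by move=> i; rewrite -perm_natM mulVg perm_nat1. Qed.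

Lemma perm_nat_tperm m (x y : 'I_m) : perm_nat (tperm x y) =1 swap_nat x y.
Proof.
move=> i; rewrite /perm_nat /swap_nat; case: insubP => [j _ <-|].
  rewrite !(inj_eq val_inj); case: tpermP => [->|->|/eqP/negPf-> /eqP/negPf-> //].
    by rewrite eqxx.
  by rewrite eqxx; case: eqP => // ->.
by rewrite -leqNgt => mi; rewrite !gtn_eqF // (leq_trans _ mi).
Qed.

Lemma content_bij_perm la m (g : 'S_m) :
  sorted geq la -> content_bij la (perm_nat g).
Proof.
move=> sla; have [ts -> _] := prod_tpermP g.
elim: ts => [|t ts IH]; first by rewrite big_nil; apply/content_bij_id/perm_nat1.
rewrite big_cons; apply: content_bij_comp (content_bij_swap sla t.1 t.2) IH _ => i.
by rewrite perm_natM perm_nat_tperm.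
Qed.

(** Equal fibre sizes make the two lists of values rearrangements of each other; the permutation of
    positions is carried to [T] through its enumeration. *)
Lemma perm_of_eq_counts (T : finType) (S : eqType) (f h : T -> S) :
  (forall v, \sum_c (f c == v) = \sum_c (h c == v)) ->
  exists sg : {perm T}, forall c, h (sg c) = f c.
Proof.
move=> fh; have: perm_eq (codom_tuple f) (codom_tuple h).
  apply/allP => v _ /=; apply/eqP.
  have E (k : T -> S) : count_mem v (codom k) = \sum_c (k c == v).
    by rewrite count_map -sum1_count big_mkcond big_enum.
  by rewrite !E.
case/tuple_permP => p pE.
pose sg c := enum_val (p (enum_rank c)).
have sgI : injective sg by move=> c d /enum_val_inj /perm_inj /enum_rank_inj.
exists (perm sgI) => c; rewrite permE /sg.
have -> : f c = tnth (codom_tuple f) (enum_rank c).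
  by rewrite (tnth_nth (f c)) /= nth_codom enum_rankK.
rewrite (_ : codom_tuple f = [tuple tnth (codom_tuple h) (p i) | i < #|T|]);
  last exact/val_inj.
by rewrite tnth_mktuple (tnth_nth (f c)) /= nth_codom.
Qed.

(** * Carrying the dots along *)

Section Lifting.
Variables (n m : nat) (la : seq nat) (g : 'S_m).
Hypothesis sla : sorted geq la.

Definition undotted (T : filling la n) : {ffun cell la -> nat} := [ffun c => (T c).1].

(** The order on letters sees only the underlying integers, so the dots are unconstrained. *)
Lemma semistandard_undotted (T : filling la n) :
  semistandard (undotted T) =
  rows_weakly_increasing T && cols_strictly_increasing T.
Proof.
congr andb; apply: eq_forallb => c; apply: eq_forallb => d.
  by rewrite !ffunE /dle /dlt -leqNgt.
by rewrite !ffunE.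
Qed.

Lemma perm_dottedK : cancel (@perm_dotted n m g) (perm_dotted g^-1%g).
Proof.
by case=> i k; rewrite /perm_dotted perm_natK.
Qed.

Lemma perm_dottedVK : cancel (perm_dotted g^-1%g) (@perm_dotted n m g).
Proof.
by case=> i k; rewrite /perm_dotted perm_natVK.
Qed.

Lemma dotted_bij (mm : n.-tuple nat) :
  exists2 psi : filling la n -> filling la n,
    set_bij (dotted_tableaux la mm) (dotted_tableaux la mm) psi &
    forall T, dotted_tableaux la mm T ->
      exists sg : {perm cell la}, forall c, psi T (sg c) = perm_dotted g (T c).
Proof.
have [phi [[phiS phiI phiE] phic]] := content_bij_perm g sla.
(* The cell permutation is a function of the undotted tableau alone, so it can be recovered from the
   image. By [sgE] the default [1] is never reached on semistandard [U]. *)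
pose sg U := odflt 1%g
  [pick s : {perm cell la} | [forall c, phi U (s c) == perm_nat g (U c)]].
have sgE U c : semistandard U -> phi U (sg U c) = perm_nat g (U c).
  move=> sU; rewrite /sg; case: pickP => [s /forallP/(_ c)/eqP //|no].
  have [v|s sE] := @perm_of_eq_counts _ _ (fun c => perm_nat g (U c)) (phi U).
    rewrite -[v](perm_natVK g) phic //; apply: eq_bigr => d _.
    by rewrite (can_eq (perm_natK g)).
  by have /negP[] := negbT (no s); apply/forallP => d; rewrite sE.
pose psi (T : filling la n) : filling la n :=
  [ffun c => (phi (undotted T) c, (T ((sg (undotted T))^-1%g c)).2)].
have psiE T c : semistandard (undotted T) ->
    psi T (sg (undotted T) c) = perm_dotted g (T c).
  by move=> sT; rewrite ffunE sgE // permK ffunE.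
have upsi T : undotted (psi T) = phi (undotted T).
  by apply/ffunP => c; rewrite !ffunE.
have tabE T : dotted_tableaux la mm T =
    (semistandard (undotted T) && has_multidegree mm T) :> Prop.
  by rewrite /dotted_tableaux /= semistandard_undotted andbA.
have mdE T : has_multidegree mm (psi T) = has_multidegree mm T.
  apply: eq_forallb => k; congr (_ == _).
  (* The cells of [psi T] with dot index [k] are the image under [sg] of those of [T]. *)
  rewrite -[RHS](card_imset _ (@perm_inj _ (sg (undotted T)))).
  apply: eq_card => c; rewrite inE ffunE /=.
  rewrite -{2}(permKV (sg (undotted T)) c) mem_imset ?inE //; exact: perm_inj.
exists psi; last first.
  by move=> T; rewrite tabE => /andP[sT _]; exists (sg (undotted T)) => c; apply: psiE.
split.
- move=> T /=; rewrite !tabE => /andP[sT mT]; rewrite mdE mT andbT upsi.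
  exact: phiS.
- move=> T T'; rewrite !inE /= !tabE => /andP[sT _] /andP[sT' _] eqT.
  (* Equal images have equal undotted preimages, hence the same [sg], and the letters can then be
     compared cell by cell. *)
  have eqU : undotted T = undotted T'.
    by apply: phiI; rewrite ?inE //= -!upsi eqT.
  apply/ffunP => c; apply: (can_inj perm_dottedK).
  by rewrite -!psiE // eqU eqT.
- move=> T'; rewrite tabE => /andP[sT' mT'].
  have [U sU UE] := phiE _ sT'.
  (* The preimage takes its integers from [phi] and pulls the dots of [T'] back along [sg U]. *)
  pose T : filling la n := [ffun c => (U c, (T' (sg U c)).2)].
  have uT : undotted T = U by apply/ffunP => c; rewrite !ffunE.
  have psiT : psi T = T'.
    apply/ffunP => c; rewrite ffunE uT UE !ffunE permKV.
    by case: (T' c).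
  exists T => //; rewrite tabE -mdE psiT mT' uT andbT; exact: sU.
Qed.

End Lifting.

(** * Monomials and symmetry of the series *)

Lemma perm_monomE n m (g : 'S_m) (M : {cmonom dotted n}) a :
  perm_monom g M a = M (perm_dotted g^-1%g a).
Proof.
have bigE (s : seq (dotted n)) (F : dotted n -> {cmonom dotted n}) :
    (\big[mmul/mone]_(b <- s) F b) a = \sum_(b <- s) F b a.
  elim: s => [|b s IH]; first by rewrite !big_nil cm1.
  by rewrite !big_cons cmM IH.
have expE (M1 : {cmonom dotted n}) k : expcmn M1 k a = k * M1 a.
  case: k => [|k]; first exact: cm1.
  rewrite /expcmn iteropS; elim: k => [|k IH]; first by rewrite mul1n.
  by rewrite iterS (cmM a M1) IH [RHS]mulSn.
rewrite /perm_monom bigE.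
under eq_bigr do rewrite expE cmU.
(* As [perm_dotted g] is bijective, only the letter [b] contributes to the exponent of [a]. *)
set b := perm_dotted _ a.
have abE c : (perm_dotted g c == a) = (c == b).
  by rewrite /b -(can_eq (perm_dottedVK g)) perm_dottedK.
under eq_bigr do rewrite abE.
case: (boolP (b \in finsupp M)) => [bM|].
  rewrite (big_fsetD1 b) //= eqxx muln1 big1_seq ?addn0 // => c.
  by rewrite in_fsetD1 /= => /andP[/negPf -> _]; rewrite muln0.
move=> bM; rewrite (fsfun_dflt bM) big1_seq // => c /= cM.
by case: eqP => [cb|_]; [rewrite cb (negPf bM) in cM | rewrite muln0].
Qed.

Lemma mdeg_tableau_monom la n (T : filling la n) : mdeg (tableau_monom T) = #|cell la|.
Proof. by rewrite mdeg_prod; under eq_bigr do rewrite mdegU; rewrite sum1_card. Qed.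

Theorem theorem6p1 (n m : nat) (la : seq nat) (mm : n.-tuple nat)
  (hla : is_partition la m) (hmm : \sum_(k < n) tnth mm k = m) :
  MacMahon_symmetric (MacMahon_Schur la mm).
Proof.
split.
  (* Every tableau monomial has degree [#|cell la|], so coefficients in higher degree are sums of
     zeros. *)
  exists #|cell la| => M; apply: contra_neqT => dM; apply: fsbig1 => T _.
  by case: eqP => // TM; rewrite -TM mdeg_tableau_monom leqnn in dM.
move=> m' g _ M; have /and3P[sla _ _] := hla.
have [psi psi_bij psiE] := dotted_bij g sla mm.
(* After reindexing the right side by [psi], it remains to see that [psi T] has monomial [M] exactly
   when [T] has monomial [perm_monom g^-1 M]. *)
rewrite /perm_series /MacMahon_Schur [RHS](@reindex_fsbig _ _ _ _ _ psi _ _ _ psi_bij).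
apply: eq_fsbigr => T; rewrite inE => /psiE[s sE]; congr (_%:R)%R.
have monE a : tableau_monom (psi T) a = tableau_monom T (perm_dotted g^-1%g a).
  rewrite !tableau_monomE (reindex_inj (@perm_inj _ s)); apply: eq_bigr => c _.
  rewrite sE; congr nat_of_bool.
  by apply/eqP/eqP => [<-|->]; rewrite ?perm_dottedK ?perm_dottedVK.
congr nat_of_bool; apply/cmP/cmP => E a.
  by rewrite monE E perm_monomE invgK perm_dottedVK.
by rewrite perm_monomE invgK -E monE perm_dottedK.
Qed.
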